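(* Let $T_3$ be a 3-tournament on $n$ vertices. Then the number of directed tetrahedra in $T_3$ is at most $\frac{1}{4}\binom{n}{4}+O(n^3)$, where the implied constant is absolute.
   Context: Orientations of finite sets are defined inductively. An orientation of a 1-set $\{x\}$ is an assignment of $+1$ or $-1$ to $x$. An orientation of a 2-set $\{a,b\}$ is a directed edge from $a$ to $b$ or from $b$ to $a$ (a directed edge from $a$ to $b$ is regarded as assigning $+1$ to $b$ and $-1$ to $a$). For $d\ge 3$, an orientation of a $d$-set consists of an orientation of each of its $(d-1)$-subsets such that these are pairwise compatible, where two oriented $(d-1)$-sets sharing a common $(d-2)$-subset are compatible if they give different orientations to that common $(d-2)$-subset. Thus an orientation of a 3-set is the same as a cyclic ordering of it, and each cyclic ordering induces a direction on each of its 2-subsets. A 3-tournament on $n$ vertices is a set of $n$ vertices together with an orientation of each of its 3-subsets. A tetrahedron is a 4-subset of the vertex set. A tetrahedron is directed if its four oriented 3-subsets are pairwise compatible, i.e. any two of its 3-subsets have cyclic orderings that induce opposite directions on their common 2-subset. *)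

(* Defs.v *)
From mathcomp Require Import all_boot all_order all_algebra.
Set Implicit Arguments.
Unset Strict Implicit.
Unset Printing Implicit Defensive.
Import GRing.Theory.
Local Open Scope ring_scope.

Section Orientations.
Variable V : finType.
Implicit Types (x : V) (p : V * V) (e t q : {set V}) (o : {set V} -> V * V).

(* The pair p stands for the directed edge from p.1 to p.2. *)
Definition is_orientation2 e p : bool :=
  (p.1 != p.2) && (e == [set p.1; p.2]).

(* Only meaningful when x is an endpoint of p. *)
Definition endpoint_sign p x : int := if x == p.2 then 1 else -1.

(* For two directed edges whose vertex sets meet exactly in x. *)
Definition compatible2 p p' x : bool := endpoint_sign p x != endpoint_sign p' x.

(* o assigns an orientation to each 2-subset of t; its values at other sets
   are irrelevant. *)
Definition is_orientation3 t o : Prop :=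
  (forall e, e \subset t -> #|e| = 2%N -> is_orientation2 e (o e)) /\
  (forall e e' x, e \subset t -> e' \subset t -> #|e| = 2%N -> #|e'| = 2%N ->
     e :&: e' = [set x] -> compatible2 (o e) (o e') x).

(* The values of orient3 at sets that do not have 3 elements are irrelevant. *)
Record tournament3 := Tournament3 {
  orient3 :> {set V} -> {set V} -> V * V;
  orient3P : forall t, #|t| = 3%N -> is_orientation3 t (orient3 t)
}.

(* For orientations o, o' of two 3-sets whose intersection is the 2-set e. *)
Definition compatible3 o o' e : bool := o e != o' e.

Definition directed_tetrahedron (T : tournament3) q : bool :=
  (#|q| == 4%N) &&
  [forall t : {set V}, forall t' : {set V},
     [&& t \subset q, t' \subset q, #|t| == 3%N, #|t'| == 3%N & t != t'] ==>
     compatible3 (T t) (T t') (t :&: t')].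

Definition directed_tetrahedra (T : tournament3) : {set {set V}} :=
  [set q | directed_tetrahedron T q].

End Orientations.

(* Main.v *)
Require Import Defs.
From mathcomp Require Import all_boot all_order all_algebra.
From mathcomp Require Import zify lra.
Import GRing.Theory.
Local Open Scope ring_scope.

(** Whether the orientation of a triple [abc] directs [ab] from [a] to [b] is an
    alternating function of three distinct vertices ([directs_swap] and
    [directs_rot]).  So a tetrahedron carries four signs, one per face, and two
    faces are compatible exactly when their signs, taken with respect to one
    ambient orientation of the tetrahedron, agree.  Four signs split as
    4 + 0, 3 + 1 or 2 + 2, and then 6, 3 or 2 of the six pairs of faces are
    compatible.  Hence each tetrahedron has at least 2 compatible pairs, and a
    directed one has all 6 ([compatible_pairs_ge]).

    On the other hand, the two faces on a common edge [ab] are compatible iff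
    they direct [ab] oppositely.  If [k] of the [n - 2] triples through [ab]
    direct it one way and [l] the other way, then [ab] lies in [k * l] compatible
    pairs, and [k * l] is at most [(n - 2) ^ 2 / 4] ([sum_compatible_le]).  So the
    total number of compatible pairs is about [3 'C(n, 4)] at most, an average of
    3 per tetrahedron; if [x] tetrahedra are directed, then
    [6 x + 2 ('C(n, 4) - x) <= 3 'C(n, 4) + O(n ^ 3)], which bounds [x] by
    ['C(n, 4) / 4 + O(n ^ 3)].

    All counts are made over ordered quadruples of distinct vertices, where the
    six edges of a tetrahedron are exchanged by permuting the summation
    variables; a tetrahedron is then counted [4`! = 24] times. *)

(** * Counting sequences of distinct elements *)

Section Counting.
Variable V : finType.
Local Open Scope nat_scope.

(** Extending a sequence by one new element is the step by which the sums over
    ordered quadruples below are evaluated. *)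
Lemma sum_uniq_rcons (A : pred V) (s : seq V) :
  \sum_x (uniq (rcons s x) && all A (rcons s x))
    = (uniq s && all A s) * (#|A| - size s).
Proof.
have [/andP[us As]|nus] := boolP (uniq s && all A s); last first.
  rewrite mul0n big1 // => x _; rewrite rcons_uniq all_rcons.
  by apply/eqP; rewrite eqb0; apply: contra nus => /andP[/andP[_ ->] /andP[_ ->]].
rewrite mul1n (eq_bigr (fun x => ([predD A & mem s] x : nat))); last first.
  by move=> x _; rewrite rcons_uniq all_rcons us As !andbT.
rewrite -big_mkcond sum1_card -(cardID (mem s) A).
have -> : #|[predI A & mem s]| = size s.
  rewrite -(card_uniqP us); apply: eq_card => x; rewrite !inE /=.
  by case: (boolP (x \in s)) => [/(allP As) Ax|_]; rewrite ?andbT ?andbF.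
by rewrite addKn; apply: eq_card => x; rewrite !inE.
Qed.

Lemma sum_uniq4 (A : pred V) :
  \sum_a \sum_b \sum_c \sum_d
      (uniq [:: a; b; c; d] && all A [:: a; b; c; d]) = #|A| ^_ 4.
Proof.
transitivity (\sum_a \sum_b \sum_c
    (uniq [:: a; b; c] && all A [:: a; b; c]) * (#|A| - 3)).
  do 3!(apply: eq_bigr => ? _); exact: (sum_uniq_rcons A [:: _; _; _]).
transitivity (\sum_a \sum_b
    (uniq [:: a; b] && all A [:: a; b]) * (#|A| - 2) * (#|A| - 3)).
  do 2!(apply: eq_bigr => ? _); rewrite -big_distrl.
  by congr (_ * _); exact: (sum_uniq_rcons A [:: _; _]).
transitivity (\sum_a
    (uniq [:: a] && all A [:: a]) * (#|A| - 1) * (#|A| - 2) * (#|A| - 3)).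
  apply: eq_bigr => ? _; rewrite -!big_distrl.
  by congr (_ * _ * _); exact: (sum_uniq_rcons A [:: _]).
rewrite -!big_distrl (sum_uniq_rcons A [::]) /= mul1n !ffactnSr ffactn0 mul1n.
by [].
Qed.

(** Adjacent transpositions generate the permutations of the four variables that
    carry one edge of a tetrahedron to any other. *)
Lemma sum4_swap12 (F : V -> V -> V -> V -> nat) :
  \sum_a \sum_b \sum_c \sum_d F b a c d = \sum_a \sum_b \sum_c \sum_d F a b c d.
Proof. exact: exchange_big. Qed.

Lemma sum4_swap23 (F : V -> V -> V -> V -> nat) :
  \sum_a \sum_b \sum_c \sum_d F a c b d = \sum_a \sum_b \sum_c \sum_d F a b c d.
Proof. by apply: eq_bigr => a _; exact: exchange_big. Qed.

Lemma sum4_swap34 (F : V -> V -> V -> V -> nat) :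
  \sum_a \sum_b \sum_c \sum_d F a b d c = \sum_a \sum_b \sum_c \sum_d F a b c d.
Proof. by do 2!(apply: eq_bigr => ? _); exact: exchange_big. Qed.

End Counting.

(** * Compatible pairs of faces *)

Section Tournament.
Context {V : finType} (T : tournament3 V).
Implicit Types a b c d : V.
Local Open Scope nat_scope.

Definition directs a b c : bool := T [set a; b; c] [set a; b] == (a, b).

(** The faces [abc] and [abd] of a tetrahedron, compatible on their edge [ab]. *)
Definition compatible_on a b c d : bool :=
  uniq [:: a; b; c; d] && (directs a b c != directs a b d).

Lemma card_set3 a b c :
  a != b -> a != c -> b != c -> #|[set a; b; c]| = 3%N.
Proof.
move=> ab ac bc; rewrite setUC cardsU1 cards2 !inE ab.
by rewrite eq_sym (negPf ac) eq_sym (negPf bc).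
Qed.

Lemma orient3_edge a b c : a != b -> a != c -> b != c ->
  T [set a; b; c] [set a; b] = if directs a b c then (a, b) else (b, a).
Proof.
move=> ab ac bc; rewrite /directs; case: eqP => // nab.
have [/(_ [set a; b])+ _] := orient3P T (card_set3 _ _ _ ab ac bc).
rewrite subsetUl cards2 ab => /(_ isT erefl) /andP[/=].
move: nab; case: (T _ _) => x y /= nab xy /eqP/setP exy.
move: (exy x) (exy y) nab; rewrite !inE !eqxx orbT /=.
move=> /orP[]/eqP ex /orP[]/eqP ey; move: xy; rewrite ex ey ?eqxx //.
Qed.

Lemma directs_swap a b c : a != b -> a != c -> b != c ->
  directs b a c = ~~ directs a b c.
Proof.
move=> ab ac bc; rewrite {1}/directs (setUC [set b]) orient3_edge //.
case: directs; rewrite ?eqxx // xpair_eqE.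
by rewrite (negPf ab).
Qed.

(** The edges [ab] and [bc] of an oriented triple give opposite signs to [b], so
    that one of them enters [b] iff the other leaves it. *)
Lemma directs_rot a b c : a != b -> a != c -> b != c ->
  directs b c a = directs a b c.
Proof.
move=> ab ac bc.
have ebca : [set b; c; a] = [set a; b; c].
  by apply/setP=> x; rewrite !inE orbC orbA.
have [_ /(_ [set a; b] [set b; c] b)] := orient3P T (card_set3 _ _ _ ab ac bc).
rewrite subsetUl !cards2 ab bc.
have -> : [set b; c] \subset [set a; b; c] by rewrite -setUA subsetUr.
have -> : [set a; b] :&: [set b; c] = [set b].
  apply/setP=> x; rewrite !inE; case: (eqVneq x b) => [->|_]; rewrite ?orbT //=.
  by rewrite orbF; case: (eqVneq x a) => [->|] //=; rewrite (negPf ac).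
move=> /(_ isT isT erefl erefl erefl).
rewrite /compatible2 orient3_edge // -ebca orient3_edge 1?eq_sym //; last first.
  by rewrite eq_sym.
by case: (directs a b c); case: (directs b c a);
   rewrite /endpoint_sign /= ?eqxx ?(negPf bc) ?(eq_sym b a) ?(negPf ab).
Qed.

(** All six edges of a directed tetrahedron reduce to this one by permuting the
    names of its vertices. *)
Lemma directed_compatible_on q a b c d :
  directed_tetrahedron T q -> uniq [:: a; b; c; d] ->
  all [in q] [:: a; b; c; d] -> compatible_on a b c d.
Proof.
move=> /andP[_ /forallP dq] u; rewrite /compatible_on u /=.
move: u; rewrite /= !inE !negb_or -!andbA => /and5P[ab ac ad bc /and3P[bd cd _]].
move=> /and5P[aq bq cq dq' _].
move: (dq [set a; b; c]) => /forallP/(_ [set a; b; d])/implyP.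
rewrite !card_set3 // !eqxx !subUset !sub1set aq bq cq dq' /=.
have -> : [set a; b; c] :&: [set a; b; d] = [set a; b].
  rewrite -setUIr; apply/setP=> x; rewrite !inE.
  by case: (eqVneq x c) => [->|]; rewrite ?(negPf cd) //= orbF.
have -> : [set a; b; c] != [set a; b; d].
  apply/eqP=> /setP/(_ c); rewrite !inE eqxx orbT (negPf cd).
  by rewrite eq_sym (negPf ac) eq_sym (negPf bc).
move=> /(_ isT); rewrite /compatible3 !orient3_edge //.
by apply: contra => /eqP->.
Qed.

(** The terms on the right are indexed by the edges of the tetrahedron, and the
    sum over [q] is 1 or 0 according to whether the tetrahedron is directed.  Its
    faces are pairwise compatible in the first case; in the second, four signs
    always form at least two equal pairs. *)
Lemma compatible_pairs_ge a b c d :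
  (2 * uniq [:: a; b; c; d]
    + 4 * \sum_(q in directed_tetrahedra T)
            (uniq [:: a; b; c; d] && all [in q] [:: a; b; c; d])
  <= compatible_on a b c d + compatible_on a c b d + compatible_on a d b c
   + compatible_on b c a d + compatible_on b d a c + compatible_on c d a b)%N.
Proof.
have [u|nu] := boolP (uniq [:: a; b; c; d]); last first.
  by rewrite big1.
set Q := [set:: [:: a; b; c; d]].
have cardQ : #|Q| = 4%N by rewrite cardsE (card_uniqP u).
have uniqQ q : q \in directed_tetrahedra T ->
    all [in q] [:: a; b; c; d] -> q = Q.
  rewrite inE => /andP[/eqP q4 _] /allP aq; apply/esym/eqP.
  rewrite eqEcard cardQ q4 leqnn andbT.
  by apply/subsetP=> x; rewrite inE => /aq.
have [dQ|ndQ] := boolP (Q \in directed_tetrahedra T).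
  rewrite (bigD1 Q dQ) big1 ?addn0 => [|q /andP[dq nq]]; last first.
    by apply/eqP; rewrite eqb0; apply: contraNN nq => /andP[_ /(uniqQ _ dq) ->].
  move: dQ; rewrite inE => dQ.
  have compQ x y z w : perm_eq [:: x; y; z; w] [:: a; b; c; d] ->
      compatible_on x y z w.
    move=> e; apply: directed_compatible_on dQ _ _; first by rewrite (perm_uniq e).
    by apply/allP=> v; rewrite (perm_mem e) => ve; rewrite /= inE.
  rewrite !compQ; try by apply/seq.permP=> p /=; lia.
  by case: (_ && _).
rewrite big1 => [|q dq]; last first.
  by apply/eqP; rewrite eqb0; apply: contraNN ndQ => /andP[_ /(uniqQ _ dq) <-].
rewrite /compatible_on; move: (u); rewrite /= !inE !negb_or -!andbA.
move=> /and5P[ab ac ad bc /and3P[bd cd _]].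
rewrite !(eq_sym c b) !(eq_sym d _) !(eq_sym b a) !(eq_sym c a).
rewrite ab ac ad bc bd cd /=.
(* Each face is brought to one reference order of its vertices, which leaves the
   four signs [abc], [abd], [acd] and [bcd]. *)
have oddE x y z : x != y -> x != z -> y != z ->
    directs x z y = ~~ directs x y z.
  by move=> xy xz yz; rewrite (directs_rot y x z) 1?directs_swap // eq_sym.
rewrite (oddE a b c) // (oddE a b d) // (oddE a c d) // (oddE b c d) //.
rewrite (directs_rot a b c) // (directs_rot a b d) // (directs_rot a c d) //.
rewrite (directs_rot b c d) //.
by do 4!case: directs.
Qed.

(** * Double counting *)

(** For fixed [a] and [b] the sum over [c] and [d] is at most [2 * k * l], where
    [k] and [l] count the triples through [ab] by the direction that they give to
    [ab].  Since [k + l = n - 2], the AM-GM inequality bounds it. *)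
Lemma sum_compatible_le :
  (2 * \sum_a \sum_b \sum_c \sum_d compatible_on a b c d
    <= #|V| * (#|V| - 1) * (#|V| - 2) ^ 2)%N.
Proof.
have pairE : (\sum_(a : V) \sum_(b : V) (a != b) = #|V| * (#|V| - 1))%N.
  transitivity (\sum_(a : V) (#|V| - 1))%N; last by rewrite sum_nat_const.
  apply: eq_bigr => a _; rewrite -[RHS]mul1n -(sum_uniq_rcons V predT [:: a]).
  by apply: eq_bigr => b _; rewrite /= !inE !andbT.
rewrite -pairE big_distrr big_distrl /=; apply: leq_sum => a _.
rewrite big_distrr big_distrl /=; apply: leq_sum => b _.
have [->|ab] := eqVneq a b.
  rewrite big1 ?muln0 // => c _; rewrite big1 // => d _.
  by rewrite /compatible_on /= !inE eqxx.
pose k := \sum_c ((c \notin [:: a; b]) && directs a b c).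
pose l := \sum_c ((c \notin [:: a; b]) && ~~ directs a b c).
have kl : (k + l = #|V| - 2)%N.
  have := sum_uniq_rcons V predT [:: a; b].
  rewrite /= !inE ab mul1n => <-; rewrite /k /l -big_split /=.
  apply: eq_bigr => c _; rewrite !inE !negb_or !andbT (eq_sym c a) (eq_sym c b).
  by case: directs; rewrite ?andbT ?andbF ?addn0 ?ab.
suff le_kl : (\sum_c \sum_d compatible_on a b c d <= 2 * (k * l))%N.
  have [agm _] := nat_AGM2 k l; rewrite mul1n -kl; apply: leq_trans agm.
  by rewrite -[4]/(2 * 2) -mulnA leq_mul2l.
have -> : (2 * (k * l) = k * l + l * k)%N by lia.
rewrite {1}/k {2}/l !big_distrl -big_split /=; apply: leq_sum => c _.
rewrite /k /l !big_distrr -big_split /=; apply: leq_sum => d _.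
rewrite /compatible_on /= !inE !negb_or !(eq_sym a) !(eq_sym b).
by case: directs; case: directs; case: (c == a); case: (c == b);
   case: (d == a); case: (d == b); case: (c == d); rewrite /= ?andbF ?ab.
Qed.

(** Let [x] be the number of directed tetrahedra.  Comparing the two bounds on
    the number of compatible pairs gives
    [96 x + 2 n ^_ 4 <= 3 n (n - 1) (n - 2) ^ 2].  The right side exceeds
    [3 n ^_ 4 = 72 'C(n, 4)] by [3 n (n - 1) (n - 2)], the source of the cubic
    error term. *)
Lemma card_directed_tetrahedra_le :
  (32 * #|directed_tetrahedra T| <= 8 * 'C(#|V|, 4) + #|V| ^ 3)%N.
Proof.
pose S F := \sum_(a : V) \sum_(b : V) \sum_(c : V) \sum_(d : V) F a b c d.
pose K a b c d : nat := compatible_on a b c d.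
have [E1 E2 E3 E4 E5] : [/\
    S (fun a b c d => K a c b d) = S K, S (fun a b c d => K a d b c) = S K,
    S (fun a b c d => K b c a d) = S K, S (fun a b c d => K b d a c) = S K &
    S (fun a b c d => K c d a b) = S K].
  have e_ac := sum4_swap23 V K.
  have e_ad := sum4_swap34 V (fun a b c d => K a c b d).
  have e_bc := sum4_swap12 V (fun a b c d => K a c b d).
  have e_bd := sum4_swap12 V (fun a b c d => K a d b c).
  have e_cd := sum4_swap23 V (fun a b c d => K b d a c).
  by rewrite /S e_cd e_bd e_bc e_ad e_ac.
have SD F G : S F + S G = S (fun a b c d => F a b c d + G a b c d).
  by do 3!(rewrite -big_split /=; apply: eq_bigr => ? _); rewrite -big_split.
have SZ m F : m * S F = S (fun a b c d => m * F a b c d).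
  by do 3!(rewrite big_distrr /=; apply: eq_bigr => ? _); rewrite big_distrr.
have S_uniq : S (fun a b c d => uniq [:: a; b; c; d]) = #|V| ^_ 4.
  rewrite -(sum_uniq4 V predT); do 4!(apply: eq_bigr => ? _).
  by rewrite all_predT andbT.
have S_dir : S (fun a b c d => \sum_(q in directed_tetrahedra T)
      (uniq [:: a; b; c; d] && all [in q] [:: a; b; c; d]))
    = 24 * #|directed_tetrahedra T|.
  rewrite mulnC -sum_nat_const.
  transitivity (\sum_(q in directed_tetrahedra T) #|q| ^_ 4); last first.
    by apply: eq_bigr => q; rewrite inE => /andP[/eqP-> _].
  under [RHS]eq_bigr => q _ do rewrite -(sum_uniq4 V [in q]).
  by do 4!(rewrite [RHS]exchange_big /=; apply: eq_bigr => ? _).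
have pairs : 2 * #|V| ^_ 4 + 4 * (24 * #|directed_tetrahedra T|) <= 6 * S K.
  rewrite -S_uniq -S_dir -[6 * _]/((1 + 1 + 1 + 1 + 1 + 1) * S K) !mulnDl !mul1n.
  (* Each rewrite trades one of the remaining copies of [S K] for the sum over
     another edge; the first copy stays as it is. *)
  rewrite -{2}E1 -{2}E2 -{2}E3 -{2}E4 -{2}E5 !SZ !SD.
  by do 4!(apply: leq_sum => ? _); exact: compatible_pairs_ge.
have := sum_compatible_le; rewrite -[\sum_a _]/(S K).
move: pairs (bin_ffact #|V| 4); rewrite !ffactnSr ffactn0 -[4`!]/24.
move: (S K) #|_| #|V| 'C(_, _) => P x n C.
case: n => [|[|[|n]]]; rewrite ?expnS; nia.
Qed.
End Tournament.

Theorem theorem2p1 :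
  exists C : rat, forall (n : nat) (V : finType) (T : tournament3 V),
    #|V| = n ->
    #|directed_tetrahedra T|%:R <= 4^-1 * 'C(n, 4)%:R + C * n%:R ^+ 3.
Proof.
exists (32%:R)^-1 => n V T <-.
have := card_directed_tetrahedra_le T.
rewrite -(Num.Theory.ler_nat rat) natrD natrX !natrM.
lra.
Qed.
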